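(* Let $\lambda\ge\omega_2$ and let $\langle X_\alpha:\alpha<\lambda\rangle$ be spaces such that $S=\{\alpha<\lambda:|X_\alpha|\ge 2\}$ has cardinality at least $\aleph_2$. Then the space ${}^{<\omega_1}\square_{\alpha<\lambda}X_\alpha$ is not normal (and hence not paracompact and not ultraparacompact).
   Context: All spaces are Hausdorff. ${}^{<\omega_1}\square_{\alpha<\lambda}X_\alpha$ is the product $\prod_{\alpha<\lambda}X_\alpha$ with the topology whose base consists of boxes $\prod_{\alpha<\lambda}O_\alpha$, $O_\alpha$ open in $X_\alpha$, with only countably many $O_\alpha\ne X_\alpha$. *)

(* Defs.v *)
From HB Require Import structures.
From mathcomp Require Import all_boot all_order.
From mathcomp Require Import all_classical.
From mathcomp Require wochoice.
From mathcomp Require Import topology.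

Set Implicit Arguments.
Unset Strict Implicit.
Unset Printing Implicit Defensive.

Local Open Scope classical_set_scope.
Local Open Scope card_scope.

(* |B| is the least cardinal greater than |A|. Every cardinal at most |B| is
   that of a subset of B, so quantifying over subsets of B suffices. *)
Definition card_succ (T U : Type) (A : set T) (B : set U) : Prop :=
  [/\ A #<= B, ~ (B #<= A) &
      forall C : set U, C `<=` B -> ~ (C #<= A) -> B #<= C].

(* |A| = aleph_n *)
Fixpoint is_aleph (n : nat) (T : Type) (A : set T) : Prop :=
  match n with
  | 0 => A #= [set: nat]
  | n'.+1 => exists B : set T, [/\ B `<=` A, is_aleph n' B & card_succ B A]
  end.

(* |A| >= aleph_n *)
Definition aleph_le (n : nat) (T : Type) (A : set T) : Prop :=
  exists2 B : set T, B `<=` A & is_aleph n B.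

(* An ordinal is represented by a type L with a (non-strict) well-order leL;
   ~~ leL x y then means y < x. The ordinal omega_n is the initial ordinal of
   cardinality aleph_n, i.e. no proper initial segment has as many elements. *)
Definition initial_segment (L : Type) (leL : rel L) (A : set L) : Prop :=
  forall x y, leL x y -> A y -> A x.

Definition is_omega (n : nat) (L : Type) (leL : rel L) (A : set L) : Prop :=
  [/\ initial_segment leL A, is_aleph n A &
      forall x, A x -> ~ (A #<= [set y | ~~ leL x y])].

(* omega_n <= the order type of (L, leL) *)
Definition omega_le (n : nat) (L : Type) (leL : rel L) : Prop :=
  exists A : set L, is_omega n leL A.

(* The product with the countably supported box topology. It is an alias, since
   [forall a, X a] carries the Tychonoff topology through [prod_topology]. *)
Definition cbox_product (L : Type) (X : L -> Type) : Type := forall a, X a.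

Section CBoxProduct.
Variables (L : Type) (X : L -> topologicalType).

HB.instance Definition _ := gen_eqMixin (cbox_product X).
HB.instance Definition _ := gen_choiceMixin (cbox_product X).

Definition box (O : forall a, set (X a)) : set (cbox_product X) :=
  [set f | forall a, O a (f a)].

Definition cboxes : set (set (cbox_product X)) :=
  [set box O | O in [set O : forall a, set (X a) |
    (forall a, open (O a)) /\ countable [set a | O a <> [set: X a]]]].

Lemma cboxes_cover : \bigcup_(B in cboxes) B = setT.
Proof.
apply/seteqP; split=> // f _; exists setT => //.
exists (fun a => setT); last by apply/seteqP; split.
split=> [a|]; first exact: openT.
by rewrite (_ : [set _ | _] = set0) //; apply/seteqP; split=> a //=; apply.
Qed.

Lemma cboxes_join (B C : set (cbox_product X)) (f : cbox_product X) :
  cboxes B -> cboxes C -> B f -> C f ->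
  exists D, [/\ cboxes D, D f & D `<=` B `&` C].
Proof.
move=> [O [Oo Oc] <-] [P [Po Pc] <-] Of Pf.
exists (box (fun a => O a `&` P a)); split.
- exists (fun a => O a `&` P a) => //; split=> [a|]; first exact: openI.
  apply: sub_countable (_ : countable ([set a | O a <> setT] `|`
                                       [set a | P a <> setT])); last first.
    by rewrite -bigcup2inE; apply: bigcup_countable => // -[|[|]].
  apply: subset_card_le => a /= OPa.
  have [Oa|] := pselect (O a = setT); last by left.
  by right=> Pa; apply: OPa; rewrite Oa Pa setTI.
- by move=> a; split; [exact: Of | exact: Pf].
- by move=> g OPg; split=> a; case: (OPg a).
Qed.

HB.instance Definition _ := isBaseTopological.Build (cbox_product X)
  cboxes_cover cboxes_join.

Lemma open_cbox_productP (U : set (cbox_product X)) :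
  open U <-> forall f, U f -> exists2 B, cboxes B & B f /\ B `<=` U.
Proof.
split=> [[D Dbox <-] f [B DB Bf]|UB].
  by exists B; [exact: Dbox | split=> // g Bg; exists B].
exists [set B | cboxes B /\ B `<=` U]; first by move=> B [].
apply/seteqP; split=> [f [B [_ BU] /BU]//|f /UB[B cB [Bf BU]]].
by exists B.
Qed.

End CBoxProduct.

Section Covers.
Variable T : topologicalType.
Implicit Types U V : set (set T).

Definition open_cover U : Prop :=
  (forall A, U A -> open A) /\ \bigcup_(A in U) A = [set: T].

Definition refines V U : Prop :=
  forall B, V B -> exists2 A, U A & B `<=` A.

Definition locally_finite U : Prop :=
  forall x : T, exists2 N, nbhs x N &
    finite_set [set A | U A /\ A `&` N !=set0].

End Covers.

(* Both notions are for Hausdorff spaces; the Hausdorff axiom is kept separate,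
   as it is in [normal_space]. *)
Definition paracompact (T : topologicalType) : Prop :=
  forall U : set (set T), open_cover U ->
    exists V : set (set T), [/\ open_cover V, refines V U & locally_finite V].

Definition ultraparacompact (T : topologicalType) : Prop :=
  forall U : set (set T), open_cover U ->
    exists V : set (set T), [/\ open_cover V, refines V U & trivIset V id].

(* Main.v *)
(* Stone's argument for the non-normality of an uncountable power of a
   countable discrete space, moved up one cardinal. An infinite set absorbs
   a factor [nat], so a set of aleph_2 coordinates with two distinct points
   contains aleph_2 disjoint countably infinite blocks, and the pattern of
   the two points on a block codes one of aleph_1 labels (aleph_1 <=
   2^aleph_0). For a label k, the labellings of the blocks in which every
   label other than k is used at most once form a closed set F_k; since
   there are more blocks than labels, F_k0 and F_k1 are disjoint for k0 <>
   k1. Given open U and V around F_k0 and F_k1, a recursion of length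
   omega_1 builds increasing countable sets I_w of blocks and an injective
   labelling e of their union such that every labelling that extends e on
   the union of the earlier I_v, and is k0 on the rest of I_w, lies in U.
   The labelling that is e on the union of all I_w and k1 elsewhere is in V,
   which only depends on countably many blocks, and these are settled before
   some stage w; being k0 on the remaining part of I_w then gives a point of
   both U and V. *)
Require Import Defs.
From mathcomp Require Import all_boot all_order.
From mathcomp Require Import all_classical.
From mathcomp Require wochoice.
From mathcomp Require Import topology.

Set Implicit Arguments.
Unset Strict Implicit.
Unset Printing Implicit Defensive.

Local Open Scope classical_set_scope.
Local Open Scope card_scope.

(** * Countability and absorption of a factor [nat] *)

Lemma sval_inj (T : Type) (P : T -> Prop) : injective (@sval T P).
Proof. by move=> [x Px] [y Py]; exact: eq_exist. Qed.

Lemma countableU (T : Type) (A B : set T) :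
  countable A -> countable B -> countable (A `|` B).
Proof.
move=> Ac Bc; rewrite -bigcup2inE; apply: bigcup_countable => //.
by move=> [|[|]].
Qed.

(** Zorn's lemma gives a maximal family [F] of injective sequences with disjoint ranges. The set [R]
    of points on no range is countable, as otherwise it would contain a further sequence. A pair
    [(f n, m)] moves along [f], and the pairs over [R] move along one fixed [f0] in [F]. *)
Lemma infinite_mul_nat (T : Type) : infinite_set [set: T] ->
  exists h : T * nat -> T, injective h.
Proof.
move=> Tinf.
pose P (F : set (nat -> T)) := forall f g n m,
  F f -> F g -> f n = g m -> f = g /\ n = m.
have chainP (C : set (set (nat -> T))) :
    C `<=` P -> total_on C subset -> P (\bigcup_(F in C) F).
  move=> CP Ctot f g n m [F CF Ff] [G CG Gg].
  by case: (Ctot F G CF CG) => [FG|GF];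
    [apply: (CP G) => //; apply: FG | apply: (CP F) => //; apply: GF].
have [F [FP Fmax]] := Zorn_bigcup chainP.
pose R : set T := [set t | forall f n, F f -> f n <> t].
have Rc : countable R.
  apply: contrapT => Rnc.
  have /infiniteP/card_leP/unsquash h : infinite_set R.
    by move=> /finite_set_countable.
  pose f n := val (h (to_setT n)).
  have fR n : R (f n) by exact: set_valP.
  have f_inj : injective f.
    by move=> n m /val_inj /inj; rewrite !inE => /(_ I I) [].
  apply: (Fmax (F `|` [set f])).
    split=> [g Fg|]; first by left.
    by move=> /(_ f (or_intror erefl)) Ff; apply: (fR 0 f 0 Ff).
  move=> g1 g2 n m [F1|->] [F2|->] e.
  - exact: FP e.
  - by case: (fR m g1 n F1).
  - by case: (fR n g2 m F2).
  - by split=> //; exact: f_inj.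
have [f0 Ff0] : F !=set0.
  apply: contrapT => F0; apply: Tinf.
  apply: contrapT => /infiniteP/card_leP/unsquash h.
  pose f n := val (h (to_setT n)).
  have f_inj : injective f.
    by move=> n m /val_inj /inj; rewrite !inE => /(_ I I) [].
  apply: (Fmax [set f]).
    by split=> [g Fg|/(_ f erefl) Ff]; [case: F0; exists g | case: F0; exists f].
  by move=> g1 g2 n m -> -> e; split=> //; exact: f_inj.
have /countable_injP[c c_inj] := Rc.
have dec t : {fn : (nat -> T) * nat | F fn.1 /\ fn.1 fn.2 = t} + {R t}.
  have [Rt|nRt] := pselect (R t); first by right.
  left; apply: cid.
  move: nRt => /existsNP[f /existsNP[n /not_implyP[Ff /contrapT e]]].
  by exists (f, n).
(* The tags [inl] and [inr] keep the images of [R] apart from those of the points on [f0]. *)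
pose h (tm : T * nat) := match dec tm.1 with
  | inleft (exist fn _) => fn.1 (pickle (inl (fn.2, tm.2) : nat * nat + nat * nat))
  | inright _ => f0 (pickle (inr (c tm.1, tm.2) : nat * nat + nat * nat)) end.
exists h => -[t m] [t' m']; rewrite /h /=.
case: (dec t) => [[[f n] [/= Ff <-]]|Rt];
  case: (dec t') => [[[f' n'] [/= Ff' <-]]|Rt'].
- by move=> /FP[] // -> /(pcan_inj pickleK) [-> ->].
- by move=> /FP[] // _ /(pcan_inj pickleK).
- by move=> /FP[] // _ /(pcan_inj pickleK).
- move=> /FP[] // _ /(pcan_inj pickleK) [/c_inj e ->].
  by rewrite e // inE.
Qed.

Lemma inj_card_leT (T U : Type) (A : set T) (f : T -> U) (B : set U) :
  (forall x, A x -> B (f x)) -> (forall x y, A x -> A y -> f x = f y -> x = y) ->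
  A #<= B.
Proof.
move=> fB f_inj.
have /injfunPex[g] : exists2 g : T -> U, set_fun A B g & set_inj A g.
  by exists f => // x y; rewrite !inE; exact: f_inj.
exact: inj_card_le.
Qed.

(** * The ordinal omega_1 *)

(* Only these properties of the ordinal omega_1 are used. *)
Record omega1_like (W : Type) (lt : W -> W -> Prop) : Prop := {
  o1_wf : well_founded lt;
  o1_trans : forall x y z, lt x y -> lt y z -> lt x z;
  o1_total : forall x y, [\/ lt x y, x = y | lt y x];
  o1_countable : forall x, countable [set y | lt y x];
  o1_uncountable : ~ countable [set: W] }.

Lemma uncountable_nat_bool : ~ countable [set: nat -> bool].
Proof.
move=> /countable_injP[f f_inj].
have [g gK] : exists g : nat -> nat -> bool, forall x, g (f x) = x.
  exists (fun n => xget (fun=> false) [set x | f x = n]) => x.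
  by apply: xget_unique => // y e; apply: f_inj; rewrite ?inE.
have := congr1 (@^~ (f (fun n => ~~ g n n))) (gK (fun n => ~~ g n n)).
by case: (g _ _).
Qed.

(** In a well-order of [nat -> bool], [W] consists of the elements with countably many predecessors.
    Were [W] countable, induction would put every element into it. *)
Lemma omega1_exists : exists (W : Type) (lt : W -> W -> Prop)
  (code : W -> nat -> bool), omega1_like lt /\ injective code.
Proof.
have [le le_wo] := wochoice.well_ordering_principle (nat -> bool).
pose lt x y := ~~ le y x.
have le_tot : total le.
  have: wochoice.wo_chain le predT by move=> A _; exact: le_wo.
  by move=> /wochoice.wo_chainW ch x y; apply: ch.
have le_refl x : le x x by have := le_tot x x; rewrite orbb.
have min (A : set (nat -> bool)) : A !=set0 ->
    exists2 x, A x & forall y, A y -> le x y.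
  move=> [a Aa]; have [|z [[/asboolP Az zmin] _]] := le_wo (fun x => `[< A x >]).
    by exists a; exact/asboolP.
  by exists z => // y Ay; apply: zmin; exact/asboolP.
have le_anti x y : le x y -> le y x -> x = y.
  move=> xy yx.
  have [|z [_ uz]] := le_wo (fun t => `[< t = x \/ t = y >]).
    by exists x; apply/asboolP; left.
  have ux : z = x.
    by apply: uz; split=> [|t /asboolP[]->//]; apply/asboolP; left.
  rewrite -ux; apply: uz; split=> [|t /asboolP[]->//].
  by apply/asboolP; right.
have le_trans x y z : le x y -> le y z -> le x z.
  move=> xy yz; have [|m m3 mmin] := min [set t | [\/ t = x, t = y | t = z]].
    by exists x; constructor 1.
  have mx := mmin x (Or31 _ _ erefl).
  have my := mmin y (Or32 _ _ erefl).
  have mz := mmin z (Or33 _ _ erefl).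
  case: m3 => em; rewrite {m mmin}em in mx my mz => //.
    by rewrite (le_anti x y).
  by rewrite -(le_anti y z).
have lt_total x y : [\/ lt x y, x = y | lt y x].
  have [xy|] := boolP (le x y); last by constructor 3.
  have [yx|] := boolP (le y x); last by constructor 1.
  by constructor 2; apply: le_anti.
have lt_trans x y z : lt x y -> lt y z -> lt x z.
  move=> xy yz; apply: contra xy => zx; apply: le_trans zx.
  by case/orP: (le_tot y z) => // zy; rewrite /lt zy in yz.
have lt_wf : well_founded lt.
  move=> x; apply: contrapT => nx.
  have [|z nz zmin] := min [set x | ~ Acc lt x]; first by exists x.
  apply: nz; constructor => y zy; apply: contrapT => ny.
  by case/negP: zy; exact: zmin.
pose W := {x : nat -> bool | countable [set y | lt y x]}.
pose ltW (x y : W) := lt (sval x) (sval y).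
exists W, ltW, sval; split; last exact: sval_inj.
split.
- move=> [x xc]; move: xc; elim/(well_founded_ind lt_wf): x => x IH xc.
  by constructor => -[y yc] yx; exact: IH.
- by move=> x y z; apply: lt_trans.
- move=> [x xc] [y yc]; have [?|?|?] := lt_total x y.
  + by constructor 1.
  + by constructor 2; exact: sval_inj.
  + by constructor 3.
- move=> [x xc]; apply: (sub_countable _ xc).
  by apply: (inj_card_leT (f := sval)) => // y z _ _ /sval_inj.
- move=> Wc; apply: uncountable_nat_bool.
  have Wc' : countable [set x | countable [set y | lt y x]].
    apply: sub_countable Wc.
    apply: card_le_trans (card_image_le sval setT).
    apply: subset_card_le => x xc; by exists (exist _ x xc).
  apply: (sub_countable _ Wc'); apply: subset_card_le => x _ /=.
  elim/(well_founded_ind lt_wf): x => x IH.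
  exact: sub_countable (subset_card_le IH) Wc'.
Qed.

(** Otherwise [W] would be the union of the countable segments up to the points of [J]. *)
Lemma omega1_bounded (W : Type) (lt : W -> W -> Prop) (J : set W) :
  omega1_like lt -> countable J -> exists x, forall y, J y -> lt y x.
Proof.
move=> o1 Jc; apply: contrapT => unb; apply: (o1_uncountable o1).
have Jc' : countable (\bigcup_(y in J) ([set x | lt x y] `|` [set y])).
  apply: bigcup_countable => // y _; apply: countableU => //.
  exact: o1_countable o1 _.
apply: sub_countable Jc'; apply: subset_card_le => x _.
apply: contrapT => nx; apply: unb; exists x => y Jy.
have [xy|e|//] := o1_total o1 x y; case: nx; exists y => //; first by left.
by right.
Qed.

(** If [j] were injective on [B], the image of a part [C] of size aleph_1 would be unbounded in [W].
    Each [j b] would then be determined by a point of that image and a position in the countable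
    segment up to it, so |B| <= |C| * aleph_0 = |C|. *)
Lemma omega1_not_ge_aleph2 (L : Type) (B : set L) (W : Type)
    (lt : W -> W -> Prop) (j : L -> W) :
  omega1_like lt -> is_aleph 2 B ->
  ~ (forall x y, B x -> B y -> j x = j y -> x = y).
Proof.
move=> o1 [C [CB [N [NC Nnat [_ CN _]]] [_ BC _]]] j_inj; apply: BC.
have Cnc : ~ countable C.
  by move=> Cc; apply: CN; rewrite (card_le_eqr Nnat).
pose T := {x | C x}.
have Tinf : infinite_set [set: T].
  move=> /finite_set_countable Tc; apply: Cnc; apply: sub_countable Tc.
  apply: card_le_trans (card_image_le sval setT).
  by apply: subset_card_le => x Cx; exists (exist _ x Cx).
have [h h_inj] := infinite_mul_nat Tinf.
have cof w : exists t : T, ~ lt (j (sval t)) w.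
  apply: contrapT => ncof; apply: Cnc; apply: sub_countable (o1_countable o1 w).
  apply: (inj_card_leT (f := j)) => [x Cx|x y Cx Cy].
    by apply: contrapT => nxw; apply: ncof; exists (exist _ x Cx).
  by apply: j_inj; exact: CB.
have [f fP] := choice cof.
have below x : countable ([set y | lt y x] `|` [set x]).
  by apply: countableU (o1_countable o1 x) _.
have [c cP] := choice (fun x => (countable_injP _ (below x))).
have le_f y : lt y (j (sval (f y))) \/ y = j (sval (f y)).
  by have [| |/fP//] := o1_total o1 y (j (sval (f y))); [left|right].
pose g b := sval (h (f (j b), c (j (sval (f (j b)))) (j b))).
apply: (inj_card_leT (f := g)).
  by move=> x Bx; exact: svalP.
move=> x y Bx By /sval_inj /h_inj [e]; rewrite -e => /cP exy.
by apply: j_inj => //; apply: exy; rewrite inE /=; [|rewrite e]; exact: le_f.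
Qed.

(** * Stone's recursion of length omega_1 *)

Lemma wf_fixpoint (W A : Type) (a : A) (lt : W -> W -> Prop)
    (G : (W -> A) -> W -> A) : well_founded lt ->
  (forall f g x, (forall y, lt y x -> f y = g y) -> G f x = G g x) ->
  exists f, forall x, f x = G f x.
Proof.
move=> lt_wf G_local.
(* [a] is a dummy value off the segment below [x]; by locality it does not affect [G]. *)
pose F x (rec : forall y, lt y x -> A) :=
  G (fun y => if pselect (lt y x) is left yx then rec y yx else a) x.
exists (Fix lt_wf (fun=> A) F) => x; rewrite Fix_eq /F.
  by apply: G_local => y yx; case: pselect.
move=> {}x f g fg; congr G; apply/funext => y.
by case: pselect => // yx; exact: fg.
Qed.

Definition injective_except (T W : Type) (k : W) (x : T -> W) : Prop :=
  forall t u, x t = x u -> t <> u -> x t = k.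

Section Stone.
Variables (T W : Type) (lt : W -> W -> Prop) (pair : W * nat -> W).
Hypotheses (o1 : omega1_like lt) (pair_inj : injective pair).

Lemma minimal_choice : inhabited W -> exists m : set W -> W,
  forall P, P !=set0 -> P (m P) /\ forall x, P x -> ~ lt x (m P).
Proof.
move=> [w].
suff /choice[m mP] : forall P : set W, exists x,
    P !=set0 -> P x /\ forall y, P y -> ~ lt y x by exists m.
move=> P.
have [|P0] := pselect (P !=set0); last by exists w.
move=> [x0 Px0]; apply: contrapT => nmin.
suff: ~ P x0 by [].
elim/(well_founded_ind (o1_wf o1)): x0 {Px0} => x IH Px; apply: nmin; exists x.
by move=> _; split=> // y Py /IH.
Qed.

Lemma inj_choice : exists c : set T -> T -> nat,
  forall J, countable J -> forall t u, J t -> J u -> c J t = c J u -> t = u.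
Proof.
suff /choice[c cP] : forall J : set T, exists c : T -> nat,
    countable J -> forall t u, J t -> J u -> c t = c u -> t = u by exists c.
move=> J; have [|nJ] := pselect (countable J); last by exists (fun=> 0).
move=> /countable_injP[c c_inj]; exists c => _ t u Jt Ju.
by apply: c_inj; rewrite inE.
Qed.

(** The first two hypotheses express openness when neighbourhoods are given by agreement on
    countable sets of blocks. The labelling e of the union is [tag I]. *)
Lemma stone_inseparable (k0 k1 : W) (U V : set (T -> W)) :
  (forall x, U x -> exists2 J, countable J &
    forall y, (forall t, J t -> y t = x t) -> U y) ->
  (forall x, V x -> exists2 J, countable J &
    forall y, (forall t, J t -> y t = x t) -> V y) ->
  injective_except k0 `<=` U -> injective_except k1 `<=` V ->
  U `&` V !=set0.
Proof.
move=> Uo Vo k0U k1V.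
have [m mP] := minimal_choice (inhabits k0).
have [c cP] := inj_choice.
have [supp suppP] : exists supp : (T -> W) -> set T, forall x,
    injective_except k0 x -> countable (supp x) /\
    forall y, (forall t, supp x t -> y t = x t) -> U y.
  suff /choice[supp suppP] : forall x, exists J : set T,
      injective_except k0 x -> countable J /\
      forall y, (forall t, J t -> y t = x t) -> U y by exists supp.
  move=> x; have [/k0U/Uo[J Jc JU]|nx] := pselect (injective_except k0 x).
    by exists J.
  by exists set0.
(* The first stage containing the block, paired with the block's index in that countable stage;
   hence distinct blocks get distinct labels. *)
pose tag (I : W -> set T) t := let w := m [set w | I w t] in pair (w, c (I w) t).
pose lab k (I : W -> set T) t := if `[< exists w, I w t >] then tag I t else k.
have lab_inj k I : (forall w, countable (I w)) -> injective_except k (lab k I).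
  move=> Ic t u; rewrite /lab.
  case: asboolP => [/mP[It _]|_ //]; case: asboolP => [/mP[Iu _]|//].
  by move=> /pair_inj[e]; rewrite -e in Iu * => /(cP _ (Ic _) _ _ It Iu).
(* Emptying the stages from [w] on makes the recursion for [I w] depend on earlier stages only. *)
pose below (I : W -> set T) w v := [set t | lt v w /\ I v t].
have [I IE] : exists I : W -> set T, forall w,
    I w = [set t | (exists v, below I w v t) \/ supp (lab k0 (below I w)) t].
  pose G I w := [set t | (exists v, below I w v t) \/
                         supp (lab k0 (below I w)) t].
  apply: (wf_fixpoint (G := G) set0 (o1_wf o1)) => f g w fg; rewrite /G.
  suff -> : below f w = below g w by [].
  by apply/funext => v; apply/seteqP; split=> t [vw]; rewrite /below /= fg.
have Ic w : countable (I w).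
  elim/(well_founded_ind (o1_wf o1)): w => w IH.
  have bc v : countable (below I w v).
    have [vw|nvw] := pselect (lt v w).
      by apply: sub_countable (IH v vw); apply: subset_card_le => t [].
    by rewrite (_ : below _ _ _ = set0) //; apply/seteqP; split=> t // [].
  rewrite IE; apply: countableU; last by have [] := suppP _ (lab_inj k0 _ bc).
  have : countable (\bigcup_(v in [set v | lt v w]) I v).
    by apply: bigcup_countable => //; exact: o1_countable o1 w.
  by apply: sub_countable; apply: subset_card_le => t [v [vw Ivt]]; exists v.
have bc w v : countable (below I w v).
  by apply: sub_countable (Ic v); apply: subset_card_le => t [].
(* Later stages do not change the first stage of a block, so its label is final. *)
have tag_below w t : (exists v, below I w v t) -> tag (below I w) t = tag I t.
  move=> ex; have [/= [lt1 I1] min1] := mP [set v | below I w v t] ex.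
  have ex' : [set v | I v t] !=set0 by case: ex => v [_ Iv]; exists v.
  have [/= I2 min2] := mP _ ex'; rewrite /tag.
  set v1 := m _ in lt1 I1 min1 *; set v2 := m _ in I2 min2 *.
  have e : v1 = v2.
    have [v12|//|v21] := o1_total o1 v1 v2; first by case: (min2 _ I1).
    by case: (min1 v2 (conj (o1_trans o1 v21 lt1) I2)).
  rewrite -e; suff -> : below I w v1 = I v1 by [].
  by apply/seteqP; split=> u // [].
have /k1V/Vo[J Jc JV] := lab_inj k1 I Ic.
(* Every block of [J] that is ever covered is covered before [w]; for the others the value of [m] is
   arbitrary and harmless. *)
have [w wJ] : exists w, forall v, [set m [set v | I v t] | t in J] v -> lt v w.
  apply: (omega1_bounded o1); exact: sub_countable (card_image_le _ _) Jc.
(* This agrees with [lab k0 (below I w)] on the support of the latter, which lies in [I w], and with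
   [lab k1 I] on [J]. *)
exists (fun t => if `[< exists v, below I w v t >] then tag I t else
  if `[< I w t >] then k0 else k1); split.
- have [_ suppU] := suppP _ (lab_inj k0 _ (bc w)).
  apply: suppU => t st; rewrite /lab.
  case: asboolP => [/tag_below//|_]; case: asboolP => // nI.
  by case: nI; rewrite IE; right.
- apply: JV => t Jt; rewrite /lab.
  have [ex|nex] := asboolP (exists v, I v t).
    have [It _] := mP _ ex; case: asboolP => // -[]; exists (m [set v | I v t]).
    by split=> //; apply: wJ; exists t.
  case: asboolP => [[v [_ Iv]]|_]; first by case: nex; exists v.
  by case: asboolP => // Iw; case: nex; exists w.
Qed.

End Stone.

(** * Separation of closed sets in normal and paracompact spaces *)

Definition open_separated (Y : topologicalType) (A B : set Y) : Prop :=
  exists U V, [/\ open U, open V, A `<=` U, B `<=` V & U `&` V = set0].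

Lemma open_separatedC (Y : topologicalType) (A B : set Y) :
  open_separated A B -> open_separated B A.
Proof. by move=> [U [V [? ? ? ? ?]]]; exists V, U; split=> //; rewrite setIC. Qed.

Lemma normal_open_separated (Y : topologicalType) (A B : set Y) :
  normal_space Y -> closed A -> closed B -> A `&` B = set0 -> open_separated A B.
Proof.
move=> normY clA clB /disjoints_subset AB.
have [|C /set_nbhsP[U [oU AU UC]] CB] := normY A clA (~` B).
  by apply/set_nbhsP; exists (~` B); split=> //; exact: closed_openC.
exists U, (~` closure C); split=> //.
- exact/closed_openC/closed_closure.
- by move=> y By /CB.
- by apply/disjoints_subset => y /UC Cy /(_ (subset_closure Cy)).
Qed.

(** Refine the cover by the complement of [A] and the open sets separated from [B]. The members that
    meet [A] are separated from [B], and by local finiteness the closure of their union misses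
    [B]. *)
Lemma paracompact_open_separated (Y : topologicalType) (A B : set Y) :
  paracompact Y -> closed A ->
  (forall a, A a -> open_separated [set a] B) -> open_separated A B.
Proof.
move=> paraY clA Asep.
pose C : set (set Y) := [set U | open U /\ (open_separated U B \/ U = ~` A)].
have [|V [[oV Vcov] VC Vfin]] := paraY C.
  split=> [U []//|]; apply/seteqP; split=> // y _.
  have [/Asep[U [U' [oU oU' yU BU' UU']]]|nAy] := pselect (A y); last first.
    by exists (~` A) => //; split; [exact: closed_openC | right].
  exists U; last exact: (yU y erefl).
  by split=> //; left; exists U, U'; split.
pose VA := [set D | V D /\ D `&` A !=set0].
pose W := \bigcup_(D in VA) D.
exists W, (~` closure W); split.
- by apply: bigcup_open => D [/oV].
- exact/closed_openC/closed_closure.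
- move=> a Aa; have [D VD Da] : (\bigcup_(D in V) D) a by rewrite Vcov.
  by exists D => //; split=> //; exists a.
- move=> b Bb clWb.
  have [N Nb Nfin] := Vfin b.
  have sepD D : exists E, VA D -> open E /\ B `<=` E /\ D `&` E = set0.
    have [[VD [a [Da Aa]]]|nD] := pselect (VA D); last by exists setT.
    have [U [_ Usep] DU] := VC D VD.
    case: Usep => [[U1 [E [_ oE UU1 BE U1E]]]|UA]; last first.
      by have := DU _ Da; rewrite UA.
    exists E => _; split=> //; split=> //.
    by apply: subsetI_eq0 U1E => //; exact: subset_trans DU UU1.
  have [E EP] := choice sepD.
  pose K := [set D | VA D /\ D `&` N !=set0].
  have Kfin : finite_set K.
    by apply: sub_finite_set Nfin => D [[VD _] DN].
  have /finite_fsetP[K' KE] := Kfin.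
  have : nbhs b (N `&` \bigcap_(D in K) E D).
    apply: filterI => //; rewrite KE; apply: filter_bigI => D DK'.
    have [VAD _] : K D by rewrite KE.
    have [oE [BE _]] := EP D VAD.
    by apply: open_nbhs_nbhs; split=> //; exact: BE.
  move=> /clWb[y [[D VAD Dy] [Ny Ey]]].
  have [_ [_ DE]] := EP D VAD.
  have : (D `&` E D) y by split=> //; apply: Ey; split=> //; exists y.
  by rewrite DE.
- by apply/disjoints_subset => y Wy /(_ (subset_closure Wy)).
Qed.

(** The previous lemma reduces [A] to a point [a], and then, with sides exchanged, [B] to a point
    [b]. *)
Lemma paracompact_hausdorff_open_separated (Y : topologicalType) (A B : set Y) :
  hausdorff_space Y -> paracompact Y -> closed A -> closed B ->
  A `&` B = set0 -> open_separated A B.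
Proof.
rewrite open_hausdorff => hY paraY clA clB AB.
apply: paracompact_open_separated => // a Aa.
apply/open_separatedC/paracompact_open_separated => // b Bb.
have /hY[[U V] /= [/set_mem Ub /set_mem Va] [oU oV /eqP UV]] : b != a.
  apply/eqP => ba; have : (A `&` B) b by split=> //; rewrite ba.
  by rewrite AB.
by exists U, V; split=> // _ ->.
Qed.

Lemma ultraparacompact_paracompact (Y : topologicalType) :
  ultraparacompact Y -> paracompact Y.
Proof.
move=> ultraY U /ultraY[V [[oV Vcov] VU Vtriv]]; exists V; split=> // y.
have [D VD Dy] : (\bigcup_(D in V) D) y by rewrite Vcov.
exists D; first by apply: open_nbhs_nbhs; split=> //; exact: oV.
apply: sub_finite_set (finite_set1 D) => E [VE [z [Ez Dz]]].
by apply: Vtriv => //; exists z.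
Qed.

(** * Open and closed sets of the countably supported box product *)

Section CBoxProduct.
Variables (L : Type) (X : L -> topologicalType).
Hypothesis X_hausdorff : forall a, hausdorff_space (X a).
Implicit Types (f g : cbox_product X) (F : set (cbox_product X)).

Lemma open_box (O : forall a, set (X a)) : (forall a, open (O a)) ->
  countable [set a | O a <> [set: X a]] -> open (box O).
Proof.
move=> Oo Oc; apply/open_cbox_productP => f Of.
by exists (box O); [exists O | split].
Qed.

Lemma open_cbox_agree (U : set (cbox_product X)) f : open U -> U f ->
  exists2 J, countable J & forall g, (forall a, J a -> g a = f a) -> U g.
Proof.
move=> /open_cbox_productP Uo /Uo[_ [O [Oo Oc] <-] [Of OU]].
exists [set a | O a <> setT] => // g gf; apply: OU => a.
have [->//|Oa] := pselect (O a = setT).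
by rewrite gf //; exact: Of.
Qed.

Lemma open_cbox_coord a (U : set (X a)) : open U ->
  open [set f : cbox_product X | U (f a)].
Proof.
move=> Uo.
(* Quantifying over [b = a] transports [U] to coordinate [a] and is vacuous elsewhere. *)
pose O b : set (X b) := [set x | forall e : b = a, U (eq_rect b X x a e)].
have Oa : O a = U.
  apply/seteqP; split=> x; first by move=> /(_ erefl).
  by move=> Ux e; rewrite (Prop_irrelevance e erefl).
have ON b : b <> a -> O b = setT.
  by move=> ba; apply/seteqP; split=> // x _ e; case: (ba e).
rewrite (_ : [set f | _] = box O); last first.
  apply/seteqP; split=> f /=; last by move=> /(_ a); rewrite Oa.
  move=> Uf b; have [->|/ON->//] := pselect (b = a); by rewrite Oa.
apply: open_box => [b|].
  by have [->|/ON->] := pselect (b = a); [rewrite Oa | exact: openT].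
apply: sub_countable (countable1 a); apply: subset_card_le => b Ob.
by apply: contrapT => /ON.
Qed.

Lemma cbox_hausdorff : hausdorff_space (cbox_product X).
Proof.
rewrite open_hausdorff => f g fg.
have [a fga] : exists a, f a <> g a.
  apply: contrapT => fgE; case/eqP: fg; apply: functional_extensionality_dep.
  by move=> a; apply: contrapT => fga; apply: fgE; exists a.
have := @X_hausdorff a; rewrite open_hausdorff => /(_ (f a) (g a)).
case; first exact/eqP.
move=> [U V] /= [/set_mem Uf /set_mem Vg] [oU oV /eqP UV].
exists ([set h : cbox_product X | U (h a)], [set h : cbox_product X | V (h a)]).
  by split; apply/mem_set.
split; [exact: open_cbox_coord|exact: open_cbox_coord|apply/eqP].
apply/seteqP; split=> h // UVh; have : (U `&` V) (h a) by [].
by rewrite UV.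
Qed.

(** If [f] is not in [F], no member of [F] agrees with it on some countable [J]. Deleting at each
    [a] in [J] those of [p a], [q a] that differ from [f a] leaves an open box around [f] that
    misses [F]. *)
Lemma closed_cbox (p q : forall a, X a) F :
  (forall f, F f -> forall a, f a = p a \/ f a = q a) ->
  (forall f, (forall J, countable J ->
     exists2 g, F g & forall a, J a -> g a = f a) -> F f) ->
  closed F.
Proof.
move=> Fpq Fapprox; rewrite -[F]setCK; apply: open_closedC.
apply/open_cbox_productP => f nFf.
have /existsNP[J /not_implyP[Jc nJ]] := contra_not (Fapprox f) nFf.
pose O a : set (X a) :=
  [set x | J a -> ~ ([set y | (y = p a \/ y = q a) /\ y <> f a] x)].
have OT a : ~ J a -> O a = setT by move=> nJa; apply/seteqP; split=> // x _ /nJa.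
exists (box O); last first.
  split=> [a Ja [_]//|g Og Fg]; apply: nJ; exists g => // a Ja.
  by apply: contrapT => ga; case: (Og a Ja); split=> //; exact: Fpq.
exists O => //; split=> [a|].
  have [Ja|/OT->] := pselect (J a); last exact: openT.
  rewrite (_ : O a = ~` [set y | (y = p a \/ y = q a) /\ y <> f a]); last first.
    by apply/seteqP; split=> x Ox; [exact: Ox Ja | move=> _].
  apply: closed_openC; apply: (accessible_finite_set_closed.1).
    exact: hausdorff_accessible.
  apply: sub_finite_set (finite_set2 (p a) (q a)).
  by move=> x [].
apply: sub_countable Jc; apply: subset_card_le => a /= Oa.
by apply: contrapT => /OT.
Qed.

End CBoxProduct.

(** * Labellings as points of the product *)

(* For fixed t the coordinates [phi (t, n)] form the t-th block. *)
Section Labellings.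
Variables (L : Type) (X : L -> topologicalType) (T W : Type).
Hypothesis X_hausdorff : forall a, hausdorff_space (X a).
Variables (phi : T * nat -> L) (code : W -> nat -> bool) (p q : forall a, X a).
Hypotheses (phi_inj : injective phi) (code_inj : injective code).
Hypothesis pq : forall tn, p (phi tn) <> q (phi tn).

Definition label_point (x : T -> W) : cbox_product X := fun a =>
  if `[< exists tn, phi tn = a /\ code (x tn.1) tn.2 >] then q a else p a.

Lemma label_pointE x t n :
  label_point x (phi (t, n)) =
  if code (x t) n then q (phi (t, n)) else p (phi (t, n)).
Proof.
rewrite /label_point; case: asboolP => [[[u m] [/phi_inj[-> ->] /= ->//]]|nx].
by case: ifP => // c; case: nx; exists (t, n).
Qed.

Lemma label_pointN x a : ~ (exists tn, phi tn = a) -> label_point x a = p a.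
Proof.
move=> na; rewrite /label_point; case: asboolP => // -[tn [e _]].
by case: na; exists tn.
Qed.

Lemma label_point_agree x y t :
  (forall n, label_point x (phi (t, n)) = label_point y (phi (t, n))) -> x t = y t.
Proof.
move=> xy; apply/code_inj/funext => n; have := xy n; rewrite !label_pointE.
by case: (code (x t) n); case: (code (y t) n) => // e; case: (@pq (t, n)).
Qed.

Lemma label_point_inj : injective label_point.
Proof.
by move=> x y xy; apply/funext => t; apply: label_point_agree => n; rewrite xy.
Qed.

(** A coordinate lies in at most one block, so countably many coordinates meet countably many
    blocks. *)
Lemma open_label_agree (U : set (cbox_product X)) x : open U ->
  U (label_point x) -> exists2 J, countable J &
    forall y, (forall t, J t -> y t = x t) -> U (label_point y).
Proof.
move=> Uo /(open_cbox_agree Uo)[J Jc JU].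
exists (\bigcup_(a in J) [set t | exists n, phi (t, n) = a]).
  apply: bigcup_countable => // a _; apply: finite_set_countable.
  have [[[t n] <-]|na] := pselect (exists tn, phi tn = a).
    by apply: sub_finite_set (finite_set1 t) => u [m /phi_inj[]].
  rewrite (_ : [set _ | _] = set0) //; apply/seteqP; split=> t //= [n e].
  by apply: na; exists (t, n).
move=> y yx; apply: JU => a Ja; rewrite /label_point.
have e tn : phi tn = a -> y tn.1 = x tn.1.
  by case: tn => t n ea; apply: yx; exists a => //; exists n.
congr (if _ then _ else _); apply/asbool_equiv_eq; split=> -[tn [ea]].
  by rewrite e // => c; exists tn.
by rewrite -e // => c; exists tn.
Qed.

(** Countable sets decide membership: a block determines its label, a coordinate off the blocks
    carries [p], and the condition on labels involves two blocks at a time. *)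
Lemma closed_injective_except (k : W) :
  closed [set label_point x | x in injective_except k].
Proof.
apply: (closed_cbox X_hausdorff (p := p) (q := q)).
  by move=> _ [x _ <-] a; rewrite /label_point; case: asboolP; [right|left].
move=> f approx.
have blockc t : countable [set phi (t, n) | n in setT].
  by apply: sub_countable (card_image_le _ _) _.
have approx1 t : exists y : W, forall n,
    f (phi (t, n)) = if code y n then q (phi (t, n)) else p (phi (t, n)).
  have [_ [x _ <-] xf] := approx _ (blockc t).
  by exists (x t) => n; rewrite -xf ?label_pointE //; exists n.
have [x xf] := choice approx1.
have fE : f = label_point x.
  apply: functional_extensionality_dep => a.
  have [[[t n] <-]|na] := pselect (exists tn, phi tn = a).
    by rewrite xf label_pointE.
  have [_ [y _ <-] /(_ a erefl) <-] := approx _ (countable1 a).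
  by rewrite !label_pointN.
rewrite fE in approx *; exists x => // t u xtu tu.
have [_ [y y_inj <-] yx] := approx _ (countableU (blockc t) (blockc u)).
have yt : y t = x t.
  by apply: label_point_agree => n; apply: yx; left; exists n.
have yu : y u = x u.
  by apply: label_point_agree => n; apply: yx; right; exists n.
by rewrite -yt; apply: (y_inj t u) => //; rewrite yt yu.
Qed.

Lemma label_points_inseparable (lt : W -> W -> Prop) (pair : W * nat -> W) k0 k1 :
  omega1_like lt -> injective pair ->
  ~ open_separated [set label_point x | x in injective_except k0]
                   [set label_point x | x in injective_except k1].
Proof.
move=> o1 pair_inj [U [V [oU oV AU BV UV]]].
have [x [Ux Vx]] := stone_inseparable o1 pair_inj
  (fun x => open_label_agree (x := x) oU) (fun x => open_label_agree (x := x) oV)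
  (fun x x_inj => AU _ (imageP label_point x_inj))
  (fun x x_inj => BV _ (imageP label_point x_inj)).
by have : (U `&` V) (label_point x) by []; rewrite UV.
Qed.

End Labellings.

(** * Two closed sets without separation, and the theorem *)

Lemma cbox_inseparable (L : Type) (X : L -> topologicalType)
  (X_nonempty : forall a : L, [set: X a] !=set0)
  (X_hausdorff : forall a : L, hausdorff_space (X a))
  (S_ge_aleph2 : aleph_le 2 [set a : L | `I_2 #<= [set: X a]]) :
  exists A B : set (cbox_product X),
    [/\ closed A, closed B, A `&` B = set0 & ~ open_separated A B].
Proof.
have [B BS B2] := S_ge_aleph2.
have [W [lt [code [o1 code_inj]]]] := omega1_exists.
have Winf : infinite_set [set: W].
  by move=> /finite_set_countable; exact: o1_uncountable o1.
have [pair pair_inj] := infinite_mul_nat Winf.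
have [w0 _] := infinite_setN0 Winf.
pose k0 := pair (w0, 0); pose k1 := pair (w0, 1).
have k01 : k0 <> k1 by move=> /pair_inj.
(* [B] serves twice: its elements index the blocks and are also the coordinates that form them. *)
pose T := {a | B a}.
have no_inj (x : T -> W) : ~ injective x.
  move=> x_inj.
  pose j b := if pselect (B b) is left Bb then x (exist _ b Bb) else w0.
  apply: (omega1_not_ge_aleph2 (j := j) o1 B2) => a b Ba Bb.
  rewrite /j; case: pselect => // {}Ba; case: pselect => // {}Bb.
  by move=> /x_inj[].
have Tinf : infinite_set [set: T].
  move=> /finite_set_countable /countable_injP[c c_inj].
  have /infiniteP/card_leP/unsquash h := Winf.
  apply: (no_inj (fun t => val (h (to_setT (c t))))) => t u.
  move=> /val_inj/inj; rewrite !inE => /(_ I I)[] /c_inj.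
  by rewrite !inE => /(_ I I).
have [phi phi_inj] := infinite_mul_nat Tinf.
(* Off [B] any pair will do; nonemptiness supplies one. *)
have X2 a : exists pq : X a * X a, B a -> pq.1 <> pq.2.
  have [Ba|nBa] := pselect (B a); last by have [z _] := X_nonempty a; exists (z, z).
  have /card_leP/unsquash h := BS _ Ba.
  pose h' n (nlt : (n < 2)%N) := val (h (SigSub (mem_set (nlt : `I_2 n)))).
  exists (h' 0 isT, h' 1 isT) => _ /= /val_inj/inj.
  by rewrite !inE => /(_ I I)[].
pose p a := (sval (cid (X2 a))).1; pose q a := (sval (cid (X2 a))).2.
pose phi' tn := sval (phi tn).
have phi'_inj : injective phi' by apply: inj_comp => //; exact: sval_inj.
have pq tn : p (phi' tn) <> q (phi' tn).
  by apply: (svalP (cid (X2 (phi' tn)))); exact: svalP (phi tn).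
exists [set label_point phi' code p q x | x in injective_except k0].
exists [set label_point phi' code p q x | x in injective_except k1].
split.
- exact: closed_injective_except.
- exact: closed_injective_except.
(* In a common member a repeated label would equal both [k0] and [k1], so the labelling would be
   injective. *)
- apply/seteqP; split=> // _ [[x x0 <-] [y y1]].
  move=> /(label_point_inj phi'_inj code_inj pq) yx; rewrite {y}yx in y1.
  apply: (no_inj x) => t u xtu; apply: contrapT => tu.
  by apply: k01; rewrite -(x0 t u) // -(y1 t u).
- exact: label_points_inseparable o1 pair_inj.
Qed.

Theorem theorem3p11 (L : Type) (leL : rel L)
  (leL_wo : wochoice.well_order leL) (L_ge_omega2 : omega_le 2 leL)
  (X : L -> topologicalType)
  (X_nonempty : forall a : L, [set: X a] !=set0)
  (X_hausdorff : forall a : L, hausdorff_space (X a))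
  (S_ge_aleph2 : aleph_le 2 [set a : L | `I_2 #<= [set: X a]]) :
  [/\ ~ normal_space (cbox_product X),
      ~ paracompact (cbox_product X) &
      ~ ultraparacompact (cbox_product X)].
Proof.
have [A [B [clA clB AB nAB]]] :=
  cbox_inseparable X_nonempty X_hausdorff S_ge_aleph2.
have not_para : ~ paracompact (cbox_product X).
  move=> para; apply: nAB.
  apply: paracompact_hausdorff_open_separated => //.
  exact: cbox_hausdorff.
split=> //.
  by move=> norm; apply: nAB; exact: normal_open_separated.
by move=> /ultraparacompact_paracompact.
Qed.
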